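(* The Hasimoto transformation is the Madelung transform in the one-dimensional case.
   Context: The Madelung transform is the mapping $\Phi\colon(\rho,\theta)\mapsto\psi$ which assigns to real-valued functions $\rho$ and $\theta$ on a manifold $M$, with $\rho>0$, the complex-valued function $\Phi(\rho,\theta)=\sqrt{\rho\,e^{\mathrm i\theta}}$, meaning $\sqrt\rho\,e^{\mathrm i\theta/2}$. The Hasimoto transformation assigns a wave function $\psi\colon\mathbb R\to\mathbb C$ to a curve $\gamma\subset\mathbb R^3$ with arc-length parameter $x$, curvature $k$ and torsion $\tau$, according to the formula $$(k(x),\tau(x))\mapsto\psi(x)=k(x)\,e^{\mathrm i\int^x\tau(\tilde x)\,d\tilde x},$$ where $\int^x$ denotes an indefinite integral. *)

(* Defs.v *)
From Stdlib Require Import Reals.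
From Coquelicot Require Import Coquelicot.

Open Scope R_scope.

(** * Calculus on the line *)

(* The bound ranges over all orders [k <= n]: since [Derive_n] is total,
   [ex_derive_n f n x] alone does not give differentiability at lower orders. *)
Definition class_C (n : nat) (f : R -> R) : Prop :=
  (forall (k : nat) (x : R), (k <= n)%nat -> ex_derive_n f k x) /\
  (forall x : R, continuous (Derive_n f n) x).

(* [F] is one of the indefinite integrals of [f] over the whole line; the
   constant of integration is left free. *)
Definition indefinite_integral (f F : R -> R) : Prop :=
  forall x : R, is_derive F x (f x).

(** * The complex exponential *)

Definition Cexp (z : C) : C :=
  (RtoC (exp (Re z)) * (RtoC (cos (Im z)) + Ci * RtoC (sin (Im z))))%C.

(** * Curves in Euclidean 3-space *)

Record vec3 : Type := Vec3 { c1 : R; c2 : R; c3 : R }.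

Definition scal3 (a : R) (u : vec3) : vec3 :=
  Vec3 (a * c1 u) (a * c2 u) (a * c3 u).

Definition dot3 (u v : vec3) : R := c1 u * c1 v + c2 u * c2 v + c3 u * c3 v.

Definition norm3 (u : vec3) : R := sqrt (dot3 u u).

Definition cross3 (u v : vec3) : vec3 :=
  Vec3 (c2 u * c3 v - c3 u * c2 v)
       (c3 u * c1 v - c1 u * c3 v)
       (c1 u * c2 v - c2 u * c1 v).

Definition deriv3 (g : R -> vec3) (x : R) : vec3 :=
  Vec3 (Derive (fun t => c1 (g t)) x)
       (Derive (fun t => c2 (g t)) x)
       (Derive (fun t => c3 (g t)) x).

Definition class_C3 (n : nat) (g : R -> vec3) : Prop :=
  class_C n (fun t => c1 (g t)) /\
  class_C n (fun t => c2 (g t)) /\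
  class_C n (fun t => c3 (g t)).

(* The Frenet apparatus, for a parametrization by arc length. *)
Definition tangent (g : R -> vec3) : R -> vec3 := deriv3 g.

Definition curvature (g : R -> vec3) (x : R) : R := norm3 (deriv3 (tangent g) x).

Definition normal (g : R -> vec3) (x : R) : vec3 :=
  scal3 (/ curvature g x) (deriv3 (tangent g) x).

Definition binormal (g : R -> vec3) (x : R) : vec3 :=
  cross3 (tangent g x) (normal g x).

(* Sign convention [B' = - tau N]: right-handed helices have positive torsion. *)
Definition torsion (g : R -> vec3) (x : R) : R :=
  - dot3 (deriv3 (binormal g) x) (normal g x).

(* Class C^3 and nonvanishing curvature are what makes the torsion well defined
   and continuous. Self-intersections are allowed. *)
Definition arclength_curve (g : R -> vec3) : Prop :=
  class_C3 3 g /\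
  (forall x : R, norm3 (tangent g x) = 1) /\
  (forall x : R, 0 < curvature g x).

(** * The two transformations *)

(* The formula makes sense on any set [M]; the one-dimensional case is [M := R]. *)
Definition madelung {M : Type} (rho theta : M -> R) (p : M) : C :=
  (RtoC (sqrt (rho p)) * Cexp (Ci * RtoC (theta p / 2)))%C.

(* [psi] is a Hasimoto wave function of the curve [g]. This is a relation
   because [psi] is determined only up to the constant phase coming from the
   indefinite integral of the torsion. *)
Definition hasimoto (g : R -> vec3) (psi : R -> C) : Prop :=
  exists T : R -> R,
    indefinite_integral (torsion g) T /\
    forall x : R, psi x = (RtoC (curvature g x) * Cexp (Ci * RtoC (T x)))%C.

Definition madelung_domain (rho theta : R -> R) : Prop :=
  class_C 1 rho /\ class_C 1 theta /\ (forall x : R, 0 < rho x).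

(* The change of variables between curves and the arguments of the Madelung
   transform: rho = k^2 and theta' = 2 tau. *)
Definition madelung_variables (g : R -> vec3) (rho theta : R -> R) : Prop :=
  (forall x : R, rho x = curvature g x ^ 2) /\
  indefinite_integral (fun x => 2 * torsion g x) theta.

(* Main.v *)
Require Import Defs.
From Stdlib Require Import Reals Lra Lia.
From Coquelicot Require Import Coquelicot.
(* [Reals] has a field projection named [c1], which would shadow the coordinate. *)
Import Defs.

Open Scope R_scope.

(** With [rho = k^2] and [theta] an antiderivative of [2 tau], the polar form
    [sqrt rho * exp (i theta / 2)] is [k * exp (i int tau)]. What remains is that
    every pair [(rho, theta)] comes from a curve, i.e. the existence part of the
    fundamental theorem of space curves on the whole line: the moving frame is
    obtained from a global solution of a linear differential system with continuous
    coefficients, and the curve by integrating the tangent. *)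

(** * Primitives, growth bounds and uniform convergence on the line *)

Lemma is_derive_continuous (f : R -> R) (x l : R) :
  is_derive f x l -> continuous f x.
Proof.
  intros H. apply (ex_derive_continuous f). exists l. exact H.
Qed.

Lemma indefinite_integral_RInt (f : R -> R) (a : R) :
  (forall x, continuous f x) -> indefinite_integral f (RInt f a).
Proof.
  intros Hf x. apply (is_derive_RInt f (RInt f a) a x).
  - exists (mkposreal 1 Rlt_0_1). intros y _.
    refine (RInt_correct _ _ _ _). refine (ex_RInt_continuous _ _ _ _). intros z _. apply Hf.
  - apply Hf.
Qed.

Lemma is_derive_0_const (f : R -> R) :
  (forall x, is_derive f x 0) -> forall x y, f x = f y.
Proof.
  intros Hf x y.
  destruct (MVT_gen f x y (fun _ => 0)) as (c & _ & Hc).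
  - intros z _. apply Hf.
  - intros z _. apply continuity_pt_filterlim. exact (is_derive_continuous _ _ _ (Hf z)).
  - lra.
Qed.

Lemma continuous_scal_real (a : R) (f : R -> R) (x : R) :
  continuous f x -> continuous (fun y => a * f y) x.
Proof. exact (continuous_scal_r (V := R_NormedModule) a f x). Qed.

Lemma continuous_sum_f_R0 (f : nat -> R -> R) (n : nat) (x : R) :
  (forall k, continuous (f k) x) ->
  continuous (fun y => sum_f_R0 (fun k => f k y) n) x.
Proof.
  intros Hf. induction n as [|n IH]; simpl.
  - apply Hf.
  - refine (continuous_plus (V := R_NormedModule) _ _ _ _ _); [exact IH | apply Hf].
Qed.

Lemma is_lim_seq_sum_f_R0 (u : nat -> nat -> R) (l : nat -> R) (n : nat) :
  (forall k, (k <= n)%nat -> is_lim_seq (u k) (l k)) ->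
  is_lim_seq (fun m => sum_f_R0 (fun k => u k m) n) (sum_f_R0 l n).
Proof.
  induction n as [|n IH]; intros Hu; simpl.
  - apply Hu. lia.
  - apply is_lim_seq_plus'; [apply IH; intros k Hk|]; apply Hu; lia.
Qed.

Lemma Rabs_sum_mult_le (a b : nat -> R) (n : nat) (K : R) :
  (forall k, (k <= n)%nat -> Rabs (b k) <= K) ->
  Rabs (sum_f_R0 (fun k => a k * b k) n)
    <= sum_f_R0 (fun k => Rabs (a k)) n * K.
Proof.
  intros Hb. eapply Rle_trans; [apply Rsum_abs|].
  rewrite Rmult_comm, scal_sum. apply sum_Rle. intros k Hk. rewrite Rabs_mult.
  apply Rmult_le_compat_l; [apply Rabs_pos | now apply Hb].
Qed.

(** The sum of the absolute values is continuous, so it attains a maximum on [[-L, L]], and it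
    dominates each of its terms. *)
Lemma finite_family_bounded (f : nat -> R -> R) (n : nat) (L : R) :
  0 <= L -> (forall k x, continuous (f k) x) ->
  exists M, 0 <= M /\
    forall k x, (k <= n)%nat -> Rabs x <= L -> Rabs (f k x) <= M.
Proof.
  intros HL Hf.
  destruct (continuity_ab_maj
    (fun x => sum_f_R0 (fun k => Rabs (f k x)) n) (- L) L) as (m & Hm & _).
  - lra.
  - intros x _. apply continuity_pt_filterlim.
    apply (continuous_sum_f_R0 (fun k x => Rabs (f k x))).
    intros k. apply continuous_Rabs_comp. apply Hf.
  - set (M := sum_f_R0 (fun k => Rabs (f k m)) n) in Hm.
    assert (HM : forall k x, (k <= n)%nat -> Rabs x <= L -> Rabs (f k x) <= M).
    { intros k x Hk Hx. apply Rabs_le_between in Hx.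
      apply Rle_trans with (2 := Hm x Hx). clear Hm M. induction n as [|n IH].
      - replace k with 0%nat by lia. apply Rle_refl.
      - simpl. destruct (Nat.eq_dec k (S n)) as [->|Hne].
        + enough (0 <= sum_f_R0 (fun k => Rabs (f k x)) n) by lra.
          apply cond_pos_sum. intros; apply Rabs_pos.
        + pose proof (Rabs_pos (f (S n) x)). specialize (IH ltac:(lia)). lra. }
    exists M. split; [|exact HM].
    apply Rle_trans with (2 := HM 0%nat 0 ltac:(lia) ltac:(rewrite Rabs_R0; lra)).
    apply Rabs_pos.
Qed.

(** The mean value theorem is applied to [phi - s * f], whose derivative is nonnegative on [[0, x]]
    when [|s| <= 1]; taking [s = 1] and [s = -1] gives the two halves of the absolute value. *)
Lemma growth_comparison_pos (f phi f' phi' : R -> R) (x : R) :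
  (forall t, is_derive f t (f' t)) -> (forall t, is_derive phi t (phi' t)) ->
  0 <= x -> (forall t, 0 <= t <= x -> Rabs (f' t) <= phi' t) ->
  Rabs (f x - f 0) <= phi x - phi 0.
Proof.
  intros Hf Hphi Hx Hb.
  assert (Hs : forall s, Rabs s <= 1 -> s * (f x - f 0) <= phi x - phi 0).
  { intros s Hs1.
    destruct (MVT_gen (fun t => phi t - s * f t) 0 x (fun t => phi' t - s * f' t))
      as (c & Hc & He).
    - intros t _. refine (is_derive_minus (V := R_NormedModule) _ _ _ _ _ _ _); [apply Hphi|]. apply is_derive_scal, Hf.
    - intros t _. apply continuity_pt_filterlim.
      apply (is_derive_continuous (fun t => phi t - s * f t) t (phi' t - s * f' t)).
      refine (is_derive_minus (V := R_NormedModule) _ _ _ _ _ _ _); [apply Hphi|]. apply is_derive_scal, Hf.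
    - rewrite Rmin_left, Rmax_right in Hc by lra.
      specialize (Hb c Hc).
      assert (s * f' c <= phi' c).
      { eapply Rle_trans; [apply Rle_abs|]. rewrite Rabs_mult.
        pose proof (Rabs_pos (f' c)). pose proof (Rabs_pos s). nra. }
      nra. }
  apply Rabs_le. split.
  - specialize (Hs (-1)). rewrite Rabs_left in Hs by lra. lra.
  - specialize (Hs 1). rewrite Rabs_R1 in Hs. lra.
Qed.

(** The reflection [t -> - t] reduces negative [x] to the previous case, so that one majorant in
    [|t|] serves both sides of the initial point. *)
Lemma growth_comparison (f phi f' phi' : R -> R) (x : R) :
  (forall t, is_derive f t (f' t)) -> (forall t, is_derive phi t (phi' t)) ->
  (forall t, Rabs t <= Rabs x -> Rabs (f' t) <= phi' (Rabs t)) ->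
  Rabs (f x - f 0) <= phi (Rabs x) - phi 0.
Proof.
  intros Hf Hphi Hb. destruct (Rle_or_lt 0 x) as [Hx|Hx].
  - rewrite (Rabs_pos_eq x) in * by exact Hx.
    apply (growth_comparison_pos f phi f' phi'); trivial.
    intros t Ht. specialize (Hb t). rewrite Rabs_pos_eq in Hb; lra.
  - rewrite (Rabs_left x) in * by exact Hx.
    pose proof (growth_comparison_pos (fun t => f (- t)) phi (fun t => - f' (- t))
      phi' (- x)) as H. simpl in H. rewrite Ropp_involutive, Ropp_0 in H.
    apply H; trivial; [|lra|].
    + intros t. auto_derive; [exists (f' (- t)); apply Hf|].
      replace (Derive (fun x0 => f x0) (- t)) with (f' (- t)); [ring|].
      symmetry. apply is_derive_unique, Hf.
    + intros t Ht. rewrite Rabs_Ropp. specialize (Hb (- t)).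
      rewrite Rabs_Ropp, Rabs_pos_eq in Hb; lra.
Qed.

Lemma exp_le (x y : R) : x <= y -> exp x <= exp y.
Proof.
  intros [H| ->]; [left; now apply exp_increasing | apply Rle_refl].
Qed.

(** The bound does not depend on the point and tends to 0, so the sequence is uniformly Cauchy on
    [D]. *)
Lemma CVU_dom_geometric (u : nat -> R -> R) (D : R -> Prop) (K : R) :
  (forall n p x, D x -> Rabs (u (n + p)%nat x - u n x) <= K * (/ 2) ^ n) ->
  CVU_dom u D.
Proof.
  intros Hu. apply CVU_dom_cauchy. intros eps.
  assert (Hlim : is_lim_seq (fun n => K * (/ 2) ^ n) 0).
  { replace (Finite 0) with (Rbar_mult K 0) by (simpl; f_equal; ring).
    apply is_lim_seq_scal_l, is_lim_seq_geom. rewrite Rabs_pos_eq; lra. }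
  apply is_lim_seq_spec in Hlim. destruct (Hlim eps) as [N HN].
  assert (Hle : forall n p x, D x -> (N <= n)%nat ->
    Rabs (u (n + p)%nat x - u n x) < eps).
  { intros n p x Hx Hn. eapply Rle_lt_trans; [apply Hu, Hx|].
    specialize (HN n Hn). rewrite Rminus_0_r in HN.
    eapply Rle_lt_trans; [apply Rle_abs | exact HN]. }
  exists N. intros n m x Hx Hn Hm. destruct (Nat.le_ge_cases n m) as [H|H].
  - rewrite Rabs_minus_sym. replace m with (n + (m - n))%nat by lia. now apply Hle.
  - replace n with (m + (n - m))%nat by lia. now apply Hle.
Qed.

(** * Linear systems of ordinary differential equations *)

Section LinearODE.

Context (d : nat) (A : nat -> nat -> R -> R) (y0 : nat -> R)
  (A_continuous : forall i j x, continuous (A i j) x).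

(** [sum_f_R0] includes both end indices: the system has the [d + 1] unknowns [0, ..., d]. *)
Let rhs (y : nat -> R -> R) (i : nat) (x : R) : R :=
  sum_f_R0 (fun j => A i j x * y j x) d.

Fixpoint picard (n : nat) (i : nat) (x : R) : R :=
  match n with
  | O => y0 i
  | S m => y0 i + RInt (rhs (picard m) i) 0 x
  end.

Lemma rhs_continuous (y : nat -> R -> R) (i : nat) (x : R) :
  (forall j, continuous (y j) x) -> continuous (rhs y i) x.
Proof.
  intros Hy. apply (continuous_sum_f_R0 (fun j x => A i j x * y j x)).
  intros j. refine (continuous_mult (K := R_AbsRing) _ _ _ _ _); [apply A_continuous | apply Hy].
Qed.

Lemma picard_continuous (n i : nat) (x : R) : continuous (picard n i) x.
Proof.
  revert i x. induction n as [|n IH]; intros i x; simpl.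
  - apply continuous_const.
  - refine (continuous_plus (V := R_NormedModule) _ _ _ _ _); [apply continuous_const|].
    apply (is_derive_continuous (RInt (rhs (picard n) i) 0) x (rhs (picard n) i x)).
    apply indefinite_integral_RInt. intros t. now apply rhs_continuous.
Qed.

Lemma picard_derive (n i : nat) (x : R) :
  is_derive (picard (S n) i) x (rhs (picard n) i x).
Proof.
  simpl. rewrite <- (Rplus_0_l (rhs (picard n) i x)).
  refine (is_derive_plus (V := R_NormedModule) _ _ _ _ _ _ _); [apply (is_derive_const (V := R_NormedModule))|].
  apply indefinite_integral_RInt. intros t. apply rhs_continuous.
  intros j. apply picard_continuous.
Qed.

Lemma picard_0 (n i : nat) : picard n i 0 = y0 i.
Proof.
  destruct n; simpl; [reflexivity|]. rewrite RInt_point. apply Rplus_0_r.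
Qed.

Lemma rhs_minus (y z : nat -> R -> R) (i : nat) (x : R) :
  rhs y i x - rhs z i x = sum_f_R0 (fun j => A i j x * (y j x - z j x)) d.
Proof.
  unfold rhs. rewrite <- minus_sum. apply sum_eq. intros; ring.
Qed.

(* Comparing with a multiple of [exp (2 M |x|)], where [M] bounds the coefficients,
   makes every Picard step a contraction of ratio 1/2. *)
Lemma picard_cauchy (L : R) : 0 <= L ->
  exists K, 0 <= K /\ forall n p i x, (i <= d)%nat -> Rabs x <= L ->
    Rabs (picard (n + p) i x - picard n i x) <= K * (/ 2) ^ n.
Proof.
  intros HL.
  (* [M] bounds the absolute row sums of the coefficients on [[-L, L]], and [C] bounds the first
     Picard increment there. *)
  destruct (finite_family_bounded
    (fun i x => sum_f_R0 (fun j => Rabs (A i j x)) d) d L HL) as (M & HM0 & HM).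
  { intros i x. apply (continuous_sum_f_R0 (fun j x => Rabs (A i j x))).
    intros j. apply continuous_Rabs_comp. apply A_continuous. }
  destruct (finite_family_bounded
    (fun i x => picard 1 i x - picard 0 i x) d L HL) as (C & HC0 & HC).
  { intros i x. refine (continuous_minus (V := R_NormedModule) _ _ _ _ _); apply picard_continuous. }
  assert (Hexp : forall t, 0 <= t -> 1 <= exp (2 * M * t)).
  { intros t Ht. pose proof (exp_ineq1_le (2 * M * t)). nra. }
  assert (Hstep : forall n i x, (i <= d)%nat -> Rabs x <= L ->
    Rabs (picard (S n) i x - picard n i x)
      <= C * (/ 2) ^ n * exp (2 * M * Rabs x)).
  { induction n as [|n IH]; intros i x Hi Hx.
    - specialize (HC i x Hi Hx). specialize (Hexp (Rabs x) (Rabs_pos x)).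
      simpl in *. nra.
    (* The factor [2 * M] produced by differentiating the exponential meets the extra [/ 2]: [phi']
       is exactly [M] times the bound at rank [n]. *)
    - set (phi := fun t => C * (/ 2) ^ S n * exp (2 * M * t)).
      assert (Hg : Rabs ((picard (S (S n)) i x - picard (S n) i x)
         - (picard (S (S n)) i 0 - picard (S n) i 0)) <= phi (Rabs x) - phi 0).
      { apply (growth_comparison (fun t => picard (S (S n)) i t - picard (S n) i t)
          phi (fun t => rhs (picard (S n)) i t - rhs (picard n) i t)
          (fun t => M * (C * (/ 2) ^ n * exp (2 * M * t)))).
        - intros t. refine (is_derive_minus (V := R_NormedModule) _ _ _ _ _ _ _); apply picard_derive.
        - intros t. unfold phi. auto_derive; [trivial|]. simpl. field.
        - intros t Ht. rewrite rhs_minus.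
          eapply Rle_trans; [apply Rabs_sum_mult_le; intros j Hj; apply IH; [exact Hj|lra]|].
          apply Rmult_le_compat_r.
          + apply Rmult_le_pos; [apply Rmult_le_pos; [exact HC0|]|left; apply exp_pos].
            apply pow_le. lra.
          + apply Rle_trans with (2 := HM i t Hi ltac:(lra)). apply Rle_abs. }
      rewrite !picard_0 in Hg.
      replace (picard (S (S n)) i x - picard (S n) i x - (y0 i - y0 i))
        with (picard (S (S n)) i x - picard (S n) i x) in Hg by ring.
      assert (0 <= phi 0).
      { unfold phi. apply Rmult_le_pos; [apply Rmult_le_pos; [exact HC0|]|left; apply exp_pos].
        apply pow_le. lra. }
      unfold phi in Hg at 1. lra. }
  set (K := C * exp (2 * M * L)).
  assert (HK : 0 <= K) by (apply Rmult_le_pos; [exact HC0 | left; apply exp_pos]).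
  exists (2 * K). split; [lra|]. intros n p i x Hi Hx.
  (* The exact partial sum of the geometric series is kept, because the bound without the subtracted
     tail is not stable under induction on [p]. *)
  enough (Rabs (picard (n + p) i x - picard n i x)
    <= 2 * K * (/ 2) ^ n - 2 * K * (/ 2) ^ (n + p)) as H.
  { assert (0 <= 2 * K * (/ 2) ^ (n + p)); [|lra].
    apply Rmult_le_pos; [lra|]. apply pow_le. lra. }
  induction p as [|p IH].
  - rewrite Nat.add_0_r, Rminus_diag, Rabs_R0. lra.
  - rewrite Nat.add_succ_r.
    replace (picard (S (n + p)) i x - picard n i x) with
      ((picard (S (n + p)) i x - picard (n + p) i x)
        + (picard (n + p) i x - picard n i x)) by ring.
    eapply Rle_trans; [apply Rabs_triang|].
    assert (Hs : Rabs (picard (S (n + p)) i x - picard (n + p) i x)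
      <= K * (/ 2) ^ (n + p)).
    { eapply Rle_trans; [apply Hstep; assumption|]. unfold K.
      replace (C * exp (2 * M * L) * (/ 2) ^ (n + p))
        with (C * (/ 2) ^ (n + p) * exp (2 * M * L)) by ring.
      apply Rmult_le_compat_l.
      - apply Rmult_le_pos; [exact HC0|]. apply pow_le. lra.
      - apply exp_le. nra. }
    rewrite <- tech_pow_Rmult. lra.
Qed.

(** On every bounded interval the iterates converge uniformly, and so do their derivatives, which
    are the right-hand sides at the preceding iterates. The limit is therefore differentiable with
    the expected derivative, and it is global because the interval is arbitrary. *)
Theorem linear_ode_exists :
  exists y : nat -> R -> R, (forall i, y i 0 = y0 i) /\
    forall i x, (i <= d)%nat ->
      is_derive (y i) x (sum_f_R0 (fun j => A i j x * y j x) d).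
Proof.
  (* [Lim_seq] is total, so [y] is defined before convergence is known; [Hcv] below provides
     convergence for indices up to [d]. *)
  set (y := fun i x => real (Lim_seq (fun n => picard n i x))).
  exists y. split.
  { intros i. unfold y. rewrite (Lim_seq_ext _ (fun _ => y0 i)).
    - now rewrite Lim_seq_const.
    - intros n. apply picard_0. }
  (* The added 1 makes [D] an open interval containing [x]. *)
  intros i x Hi. set (L := Rabs x + 1).
  assert (HL : 0 <= L) by (pose proof (Rabs_pos x); unfold L; lra).
  set (D := fun t => Rabs t < L).
  destruct (picard_cauchy L HL) as (K & HK0 & HK).
  destruct (finite_family_bounded
    (fun i x => sum_f_R0 (fun j => Rabs (A i j x)) d) d L HL) as (M & HM0 & HM).
  { intros k t. apply (continuous_sum_f_R0 (fun j x => Rabs (A k j x))).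
    intros j. apply continuous_Rabs_comp. apply A_continuous. }
  assert (Hcv : forall j t, (j <= d)%nat -> D t ->
    is_lim_seq (fun n => picard n j t) (y j t)).
  { intros j t Hj Ht. apply Lim_seq_correct'.
    apply (CVU_CVS_dom (fun n t => picard n j t) D); [|exact Ht].
    apply (CVU_dom_geometric _ _ K). intros n p s Hs. apply HK; [exact Hj|].
    unfold D in Hs; lra. }
  assert (HD : D x) by (unfold D, L; lra).
  assert (HE : forall n t, Derive (picard (S n) i) t = rhs (picard n) i t).
  { intros n t. apply is_derive_unique, picard_derive. }
  (* The right-hand side is rewritten as the limit of the derivatives, the form in which termwise
     differentiation delivers it. *)
  replace (sum_f_R0 (fun j => A i j x * y j x) d)
    with (real (Lim_seq (fun n => Derive (picard (S n) i) x))).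
  2: { rewrite (Lim_seq_ext _ (fun n => rhs (picard n) i x)).
       - rewrite (is_lim_seq_unique _ (sum_f_R0 (fun j => A i j x * y j x) d)); [reflexivity|].
         apply (is_lim_seq_sum_f_R0 (fun j n => A i j x * picard n j x)).
         intros j Hj. apply is_lim_seq_mult'; [apply is_lim_seq_const | now apply Hcv].
       - intros n. apply HE. }
  (* The shift by one leaves the limit unchanged and makes [picard_derive] apply to every term. *)
  apply is_derive_ext with (fun t => real (Lim_seq (fun n => picard (S n) i t))).
  { intros t. unfold y. f_equal. exact (Lim_seq_incr_1 (fun n => picard n i t)). }
  apply (CVU_Derive (fun n => picard (S n) i) D).
  - apply (open_comp Rabs (fun u => u < L)).
    + intros t _. apply continuous_Rabs.
    + apply open_lt.
  - intros a b t Ha Hb Ht. unfold D in *. apply Rabs_lt_between in Ha, Hb.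
    apply Rabs_lt_between. lra.
  - apply (CVU_dom_geometric _ _ K). intros n p s Hs.
    apply Rle_trans with (K * (/ 2) ^ S n).
    + apply (HK (S n)); [exact Hi | unfold D in Hs; lra].
    + rewrite <- tech_pow_Rmult.
      assert (0 <= K * (/ 2) ^ n); [|lra].
      apply Rmult_le_pos; [exact HK0|]. apply pow_le; lra.
  - intros n t _. eexists. apply picard_derive.
  - intros n t _. apply continuity_pt_filterlim.
    apply (continuous_ext (rhs (picard n) i)); [intros; symmetry; apply HE|].
    apply rhs_continuous. intros j. apply picard_continuous.
  (* By linearity, differences of derivatives are coefficient sums of differences of iterates,
     whence the constant [M * K]. *)
  - apply (CVU_dom_geometric _ _ (M * K)). intros n p s Hs. unfold D in Hs.
    rewrite !HE, rhs_minus, Rmult_assoc.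
    eapply Rle_trans; [apply Rabs_sum_mult_le; intros j Hj; apply HK; [exact Hj|lra]|].
    apply Rmult_le_compat_r.
    + apply Rmult_le_pos; [exact HK0|]. apply pow_le; lra.
    + apply Rle_trans with (2 := HM i s Hi ltac:(lra)). apply Rle_abs.
  - exact HD.
Qed.

End LinearODE.

(** * Functions of class C^n *)

Lemma class_C_0 (f : R -> R) : class_C 0 f <-> forall x, continuous f x.
Proof.
  split; [intros [_ H]; exact H|].
  intros H. split; [|exact H]. intros k x Hk. now replace k with 0%nat by lia.
Qed.

(** This recursive form of the definition is what the closure properties below use for induction on
    [n]. *)
Lemma class_C_S (n : nat) (f : R -> R) :
  class_C (S n) f <-> (forall x, ex_derive f x) /\ class_C n (Derive f).
Proof.
  assert (HD : forall k x, Derive_n (Derive f) k x = Derive_n f (S k) x).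
  { intros k x. rewrite <- Nat.add_1_r. exact (Derive_n_comp f k 1 x). }
  split.
  - intros [Hd Hc]. split; [intros x; apply (Hd 1%nat); lia|]. split.
    + intros [|k] x Hk; [exact I|].
      apply (ex_derive_ext (Derive_n f (S k))); [intros; symmetry; apply HD|].
      apply (Hd (S (S k))). lia.
    + intros x. apply (continuous_ext (Derive_n f (S n))); [intros; symmetry; apply HD|].
      apply Hc.
  - intros [Hf [Hd Hc]]. split.
    + intros [|[|k]] x Hk; [exact I | apply Hf|].
      apply (ex_derive_ext (Derive_n (Derive f) k)); [apply HD|].
      apply (Hd (S k)). lia.
    + intros x. apply (continuous_ext (Derive_n (Derive f) n)); [apply HD|]. apply Hc.
Qed.

Lemma class_C_ext (n : nat) (f g : R -> R) :
  (forall x, f x = g x) -> class_C n f -> class_C n g.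
Proof.
  intros Hfg [Hd Hc]. split.
  - intros k x Hk. apply (ex_derive_n_ext f); [exact Hfg | now apply Hd].
  - intros x. apply (continuous_ext (Derive_n f n)); [|apply Hc].
    intros t. now apply Derive_n_ext.
Qed.

Lemma class_C_is_derive (n : nat) (f f' : R -> R) :
  (forall x, is_derive f x (f' x)) -> class_C n f' -> class_C (S n) f.
Proof.
  intros Hf Hf'. apply class_C_S. split; [intros x; exists (f' x); apply Hf|].
  apply (class_C_ext n f'); [|exact Hf'].
  intros x. symmetry. apply is_derive_unique, Hf.
Qed.

Lemma class_C_pred (n : nat) (f : R -> R) : class_C (S n) f -> class_C n f.
Proof.
  intros [Hd _]. split; [intros k x Hk; apply Hd; lia|].
  intros x. apply (ex_derive_continuous (Derive_n f n)). apply (Hd (S n)). lia.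
Qed.

Lemma class_C_continuous (n : nat) (f : R -> R) (x : R) :
  class_C n f -> continuous f x.
Proof.
  intros Hf. induction n as [|n IH].
  - exact (proj1 (class_C_0 f) Hf x).
  - exact (IH (class_C_pred n f Hf)).
Qed.

Lemma class_C_Derive (n : nat) (f : R -> R) :
  class_C (S n) f -> class_C n (Derive f).
Proof. intros H. now apply class_C_S in H. Qed.

Lemma class_C_is_derive_Derive (n : nat) (f : R -> R) (x : R) :
  class_C (S n) f -> is_derive f x (Derive f x).
Proof. intros H. apply Derive_correct. now apply class_C_S in H. Qed.

Lemma class_C_const (n : nat) (c : R) : class_C n (fun _ => c).
Proof.
  revert c. induction n as [|n IH]; intros c.
  - apply class_C_0. intros x. apply continuous_const.
  - apply (class_C_is_derive n _ (fun _ => 0)); [|apply IH].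
    intros x. apply (is_derive_const (V := R_NormedModule)).
Qed.

Lemma class_C_plus (n : nat) (f g : R -> R) :
  class_C n f -> class_C n g -> class_C n (fun x => f x + g x).
Proof.
  revert f g. induction n as [|n IH]; intros f g Hf Hg.
  - rewrite class_C_0 in *. intros x.
    exact (continuous_plus (V := R_NormedModule) f g x (Hf x) (Hg x)).
  - apply (class_C_is_derive n _ (fun x => Derive f x + Derive g x)).
    + intros x. apply (is_derive_plus (V := R_NormedModule) f g);
        now apply (class_C_is_derive_Derive n).
    + apply IH; now apply class_C_Derive.
Qed.

Lemma class_C_mult (n : nat) (f g : R -> R) :
  class_C n f -> class_C n g -> class_C n (fun x => f x * g x).
Proof.
  revert f g. induction n as [|n IH]; intros f g Hf Hg.
  - rewrite class_C_0 in *. intros x.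
    exact (continuous_mult (K := R_AbsRing) f g x (Hf x) (Hg x)).
  - apply (class_C_is_derive n _ (fun x => Derive f x * g x + f x * Derive g x)).
    + intros x. apply (is_derive_mult (K := R_AbsRing) f g x (Derive f x) (Derive g x));
        try (now apply (class_C_is_derive_Derive n)). exact Rmult_comm.
    + apply class_C_plus; apply IH;
        [apply class_C_Derive | apply class_C_pred | apply class_C_pred | apply class_C_Derive];
        assumption.
Qed.

Lemma class_C_scal (n : nat) (c : R) (f : R -> R) :
  class_C n f -> class_C n (fun x => c * f x).
Proof. apply class_C_mult, class_C_const. Qed.

Lemma class_C_opp (n : nat) (f : R -> R) :
  class_C n f -> class_C n (fun x => - f x).
Proof.
  intros Hf. apply (class_C_ext n (fun x => (-1) * f x)); [intros; ring|].
  now apply class_C_scal.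
Qed.

Lemma class_C_minus (n : nat) (f g : R -> R) :
  class_C n f -> class_C n g -> class_C n (fun x => f x - g x).
Proof. intros Hf Hg. apply class_C_plus; [|apply class_C_opp]; assumption. Qed.

(** The derivative [- f' * (/ f)^2] involves only [f'] and [/ f] itself, which the induction
    hypothesis covers one order lower. The square root below is treated likewise, with
    [f' / (2 * sqrt f)]. *)
Lemma class_C_inv (n : nat) (f : R -> R) :
  (forall x, f x <> 0) -> class_C n f -> class_C n (fun x => / f x).
Proof.
  intros Hne. induction n as [|n IH]; intros Hf.
  - rewrite class_C_0 in *. intros x. now apply continuous_Rinv_comp.
  - apply (class_C_is_derive n _ (fun x => - (Derive f x * (/ f x * / f x)))).
    + intros x. replace (- _) with (- Derive f x / f x ^ 2) by (field; apply Hne).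
      apply is_derive_inv; [now apply (class_C_is_derive_Derive n) | apply Hne].
    + specialize (IH (class_C_pred _ _ Hf)).
      apply class_C_opp. apply class_C_mult; [now apply class_C_Derive|].
      now apply class_C_mult.
Qed.

Lemma class_C_sqrt (n : nat) (f : R -> R) :
  (forall x, 0 < f x) -> class_C n f -> class_C n (fun x => sqrt (f x)).
Proof.
  intros Hpos. induction n as [|n IH]; intros Hf.
  - rewrite class_C_0 in *. intros x. now apply continuous_sqrt_comp.
  - apply (class_C_is_derive n _ (fun x => Derive f x * / (2 * sqrt (f x)))).
    + intros x. apply is_derive_sqrt; [now apply (class_C_is_derive_Derive n) | apply Hpos].
    + apply class_C_mult; [now apply class_C_Derive|].
      apply class_C_inv; [|apply class_C_scal, IH, class_C_pred, Hf].
      intros x. pose proof (sqrt_lt_R0 _ (Hpos x)). lra.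
Qed.

(** * Regularity of vector-valued functions *)

Lemma class_C3_deriv3 (n : nat) (g : R -> vec3) :
  class_C3 (S n) g -> class_C3 n (deriv3 g).
Proof. intros (H1 & H2 & H3). repeat split; now apply class_C_Derive. Qed.

Lemma class_C3_pred (n : nat) (g : R -> vec3) : class_C3 (S n) g -> class_C3 n g.
Proof. intros (H1 & H2 & H3). split; [|split]; now apply class_C_pred. Qed.

Lemma class_C_dot3 (n : nat) (u v : R -> vec3) :
  class_C3 n u -> class_C3 n v -> class_C n (fun x => dot3 (u x) (v x)).
Proof.
  intros (Hu1 & Hu2 & Hu3) (Hv1 & Hv2 & Hv3).
  apply class_C_plus; [apply class_C_plus|]; now apply class_C_mult.
Qed.

Lemma class_C3_scal3 (n : nat) (a : R -> R) (u : R -> vec3) :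
  class_C n a -> class_C3 n u -> class_C3 n (fun x => scal3 (a x) (u x)).
Proof. intros Ha (H1 & H2 & H3). split; [|split]; now apply class_C_mult. Qed.

Lemma class_C3_cross3 (n : nat) (u v : R -> vec3) :
  class_C3 n u -> class_C3 n v -> class_C3 n (fun x => cross3 (u x) (v x)).
Proof.
  intros (Hu1 & Hu2 & Hu3) (Hv1 & Hv2 & Hv3).
  split; [|split]; apply class_C_minus; now apply class_C_mult.
Qed.

(** * Curvature and torsion *)

Lemma dot3_self_nonneg (u : vec3) : 0 <= dot3 u u.
Proof. unfold dot3. nra. Qed.

(** The second derivative of the curve is of class C^1, and positive curvature keeps its squared
    norm away from 0, where the square root is not differentiable. *)
Lemma arclength_curve_curvature_C (g : R -> vec3) :
  arclength_curve g -> class_C 1 (curvature g).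
Proof.
  intros (Hg & _ & Hk). unfold curvature, norm3 in *. apply class_C_sqrt.
  - intros x. specialize (Hk x). destruct (dot3_self_nonneg (deriv3 (tangent g) x)) as [H|H].
    + exact H.
    + rewrite <- H, sqrt_0 in Hk. lra.
  - apply class_C_dot3; now apply class_C3_deriv3, class_C3_deriv3.
Qed.

(** Since the curvature is C^1 and nonzero, the normal is C^1; so is the binormal, whose derivative
    is then continuous. *)
Lemma arclength_curve_torsion_continuous (g : R -> vec3) (x : R) :
  arclength_curve g -> continuous (torsion g) x.
Proof.
  intros Hg. pose proof (arclength_curve_curvature_C g Hg) as Hk.
  destruct Hg as (Hg & _ & Hpos).
  assert (HN : class_C3 1 (normal g)).
  { apply class_C3_scal3; [|now apply class_C3_deriv3, class_C3_deriv3].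
    apply class_C_inv; [|exact Hk]. intros t. specialize (Hpos t). lra. }
  apply (class_C_continuous 0). apply class_C_opp, class_C_dot3.
  - apply class_C3_deriv3. apply class_C3_cross3; [|exact HN].
    now apply class_C3_pred, class_C3_deriv3.
  - now apply class_C3_pred.
Qed.

(** Continuity of the torsion makes each of its primitives C^1, whatever the constant of
    integration. *)
Lemma torsion_primitive_domain (g : R -> vec3) (theta : R -> R) :
  arclength_curve g -> indefinite_integral (fun x => 2 * torsion g x) theta ->
  madelung_domain (fun x => curvature g x ^ 2) theta.
Proof.
  intros Hg Hth. split; [|split].
  - apply (class_C_ext 1 (fun x => curvature g x * curvature g x)); [intros; simpl; ring|].
    apply class_C_mult; now apply arclength_curve_curvature_C.
  - apply (class_C_is_derive 0 _ (fun x => 2 * torsion g x)); [exact Hth|].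
    apply class_C_0. intros x. apply continuous_scal_real. now apply arclength_curve_torsion_continuous.
  - intros x. apply pow_lt. apply Hg.
Qed.

(** * Curves with prescribed curvature and torsion *)

(** Unlike the total function [deriv3], this relation also asserts differentiability. *)
Definition is_derive3 (g : R -> vec3) (x : R) (v : vec3) : Prop :=
  is_derive (fun t => c1 (g t)) x (c1 v) /\
  is_derive (fun t => c2 (g t)) x (c2 v) /\
  is_derive (fun t => c3 (g t)) x (c3 v).

Lemma is_derive3_unique (g : R -> vec3) (x : R) (v : vec3) :
  is_derive3 g x v -> deriv3 g x = v.
Proof.
  intros (H1 & H2 & H3). destruct v as [v1 v2 v3].
  unfold deriv3. f_equal; now apply is_derive_unique.
Qed.

Lemma deriv3_ext (g h : R -> vec3) (x : R) :
  (forall t, g t = h t) -> deriv3 g x = deriv3 h x.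
Proof.
  intros H. unfold deriv3. f_equal; apply Derive_ext; intros t; now rewrite H.
Qed.

Lemma class_C3_is_derive3 (n : nat) (g g' : R -> vec3) :
  (forall x, is_derive3 g x (g' x)) -> class_C3 n g' -> class_C3 (S n) g.
Proof.
  intros Hg (H1 & H2 & H3).
  split; [|split].
  - exact (class_C_is_derive _ _ _ (fun x => proj1 (Hg x)) H1).
  - exact (class_C_is_derive _ _ _ (fun x => proj1 (proj2 (Hg x))) H2).
  - exact (class_C_is_derive _ _ _ (fun x => proj2 (proj2 (Hg x))) H3).
Qed.

Lemma is_derive3_class_C3_0 (g g' : R -> vec3) :
  (forall x, is_derive3 g x (g' x)) -> class_C3 0 g.
Proof.
  intros Hg. split; [|split]; apply class_C_0; intros x; destruct (Hg x) as (H1 & H2 & H3).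
  - exact (is_derive_continuous _ _ _ H1).
  - exact (is_derive_continuous _ _ _ H2).
  - exact (is_derive_continuous _ _ _ H3).
Qed.

Definition add3 (u v : vec3) : vec3 := Vec3 (c1 u + c1 v) (c2 u + c2 v) (c3 u + c3 v).

(** The Frenet-Serret equations, followed by the algebraic relations from which the curvature,
    normal and binormal of the integrated curve are recovered. *)
Definition frenet_frame (k tau : R -> R) (T N B : R -> vec3) : Prop :=
  (forall x, is_derive3 T x (scal3 (k x) (N x))) /\
  (forall x, is_derive3 N x (add3 (scal3 (- k x) (T x)) (scal3 (tau x) (B x)))) /\
  (forall x, is_derive3 B x (scal3 (- tau x) (N x))) /\
  (forall x, dot3 (T x) (T x) = 1) /\
  (forall x, dot3 (N x) (N x) = 1) /\
  (forall x, cross3 (T x) (N x) = B x).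

(* The frame is the rotation attached to the quaternion [q = (a, b, c, d)] solving
   [q' = q omega / 2], where [omega = (0, tau, 0, k)] is the Darboux vector
   [tau T + k B] read in the moving frame. Orthonormality and orientation of the
   frame then reduce to [|q| = 1], which holds since [|q|^2] has zero derivative. *)
Lemma frenet_frame_exists (k tau : R -> R) :
  (forall x, continuous k x) -> (forall x, continuous tau x) ->
  exists T N B : R -> vec3, frenet_frame k tau T N B.
Proof.
  intros Hk Htau.
  (* [A] is the matrix of right multiplication by [omega / 2] on quaternions; the initial value
     chosen below is the quaternion 1. *)
  set (A := fun i j : nat => match i, j with
    | 0%nat, 1%nat => fun x => - / 2 * tau x
    | 0%nat, 3%nat => fun x => - / 2 * k x
    | 1%nat, 0%nat => fun x => / 2 * tau x
    | 1%nat, 2%nat => fun x => / 2 * k x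
    | 2%nat, 1%nat => fun x => - / 2 * k x
    | 2%nat, 3%nat => fun x => / 2 * tau x
    | 3%nat, 0%nat => fun x => / 2 * k x
    | 3%nat, 2%nat => fun x => - / 2 * tau x
    | _, _ => fun _ => 0
    end).
  assert (HA : forall i j x, continuous (A i j) x).
  { assert (H0 : forall x, continuous (fun _ : R => 0) x) by (intros; apply continuous_const).
    intros [|[|[|[|i]]]] [|[|[|[|j]]]]; simpl; auto using continuous_scal_real. }
  destruct (linear_ode_exists 3 A (fun i => match i with O => 1 | _ => 0 end) HA)
    as (q & Hq0 & Hq).
  set (a := q 0%nat). set (b := q 1%nat). set (c := q 2%nat). set (d := q 3%nat).
  assert (Ha : forall x, is_derive a x (/ 2 * (- b x * tau x - d x * k x))).
  { intros x. evar_last; [apply (Hq 0%nat); lia|]. simpl. unfold b, d. ring. }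
  assert (Hb : forall x, is_derive b x (/ 2 * (a x * tau x + c x * k x))).
  { intros x. evar_last; [apply (Hq 1%nat); lia|]. simpl. unfold a, c. ring. }
  assert (Hc : forall x, is_derive c x (/ 2 * (- b x * k x + d x * tau x))).
  { intros x. evar_last; [apply (Hq 2%nat); lia|]. simpl. unfold b, d. ring. }
  assert (Hd : forall x, is_derive d x (/ 2 * (a x * k x - c x * tau x))).
  { intros x. evar_last; [apply (Hq 3%nat); lia|]. simpl. unfold a, c. ring. }
  assert (Hea : forall x, ex_derive a x) by (intros x; eexists; apply Ha).
  assert (Heb : forall x, ex_derive b x) by (intros x; eexists; apply Hb).
  assert (Hec : forall x, ex_derive c x) by (intros x; eexists; apply Hc).
  assert (Hed : forall x, ex_derive d x) by (intros x; eexists; apply Hd).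
  assert (Da := fun x => is_derive_unique a x _ (Ha x)).
  assert (Db := fun x => is_derive_unique b x _ (Hb x)).
  assert (Dc := fun x => is_derive_unique c x _ (Hc x)).
  assert (Dd := fun x => is_derive_unique d x _ (Hd x)).
  assert (Hnorm : forall x, a x * a x + b x * b x + c x * c x + d x * d x = 1).
  { intros x.
    rewrite (is_derive_0_const
      (fun x => a x * a x + b x * b x + c x * c x + d x * d x)) with (y := 0).
    - unfold a, b, c, d. rewrite !Hq0. ring.
    - intros t. auto_derive; [repeat split; trivial|].
      rewrite Da, Db, Dc, Dd. field. }
  (* The columns of the rotation matrix of [q], that is, the images of the three imaginary units
     under [v -> q v conj(q)]. *)
  exists (fun x => Vec3 (a x * a x + b x * b x - c x * c x - d x * d x)
                        (2 * (b x * c x + a x * d x)) (2 * (b x * d x - a x * c x))).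
  exists (fun x => Vec3 (2 * (b x * c x - a x * d x))
                        (a x * a x - b x * b x + c x * c x - d x * d x)
                        (2 * (c x * d x + a x * b x))).
  exists (fun x => Vec3 (2 * (b x * d x + a x * c x)) (2 * (c x * d x - a x * b x))
                        (a x * a x - b x * b x - c x * c x + d x * d x)).
  split; [|split; [|split; [|split; [|split]]]].
  (* Differentiating [q v conj(q)] yields [q w conj(q)] with [w] the cross product of [omega] and
     [v]; for the three imaginary units these are the Frenet equations. *)
  1-3: intros x; split; [|split]; simpl;
    (auto_derive; [repeat split; trivial | rewrite ?Da, ?Db, ?Dc, ?Dd; field]).
  - intros x. unfold dot3; simpl.
    (* As polynomials, the squared lengths of [T] and [N] equal [|q|^4], and the cross product of
       [T] and [N] is [|q|^2] times [B]. *)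
    transitivity ((a x * a x + b x * b x + c x * c x + d x * d x) ^ 2); [ring|].
    rewrite Hnorm. ring.
  - intros x. unfold dot3; simpl.
    transitivity ((a x * a x + b x * b x + c x * c x + d x * d x) ^ 2); [ring|].
    rewrite Hnorm. ring.
  - intros x. unfold cross3; simpl. specialize (Hnorm x). f_equal.
    + transitivity ((a x * a x + b x * b x + c x * c x + d x * d x)
        * (2 * (b x * d x + a x * c x))); [ring|]. rewrite Hnorm. ring.
    + transitivity ((a x * a x + b x * b x + c x * c x + d x * d x)
        * (2 * (c x * d x - a x * b x))); [ring|]. rewrite Hnorm. ring.
    + transitivity ((a x * a x + b x * b x + c x * c x + d x * d x)
        * (a x * a x - b x * b x - c x * c x + d x * d x)); [ring|]. rewrite Hnorm. ring.
Qed.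

(** The integral of [T] has unit tangent [T]; its normal and binormal are then forced to be [N] and
    [B], and the Frenet equations give back [k] and [tau]. *)
Theorem arclength_curve_exists (k tau : R -> R) :
  class_C 1 k -> (forall x, 0 < k x) -> (forall x, continuous tau x) ->
  exists g : R -> vec3, arclength_curve g /\
    (forall x, curvature g x = k x) /\ (forall x, torsion g x = tau x).
Proof.
  intros Hk Hpos Htau.
  destruct (frenet_frame_exists k tau) as (T & N & B & HT & HN & HB & HTT & HNN & HTN).
  { intros x. exact (class_C_continuous 1 k x Hk). }
  { exact Htau. }
  (* Regularity is bootstrapped through the Frenet equations: [B] and [N] continuous, then [T] C^1,
     [N] C^1, [T] C^2, and finally the curve C^3. *)
  assert (CB0 : class_C3 0 B).
  { now apply (is_derive3_class_C3_0 B _ HB). }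
  assert (CN0 : class_C3 0 N).
  { now apply (is_derive3_class_C3_0 N _ HN). }
  assert (CT1 : class_C3 1 T).
  { apply (class_C3_is_derive3 0 _ _ HT), class_C3_scal3; [now apply class_C_pred | exact CN0]. }
  assert (CN1 : class_C3 1 N).
  { apply (class_C3_is_derive3 0 _ _ HN).
    assert (Hsk := class_C3_scal3 0 _ T (class_C_opp _ _ (class_C_pred _ _ Hk))
      (class_C3_pred _ _ CT1)).
    assert (Hst := class_C3_scal3 0 tau B (proj2 (class_C_0 tau) Htau) CB0).
    destruct Hsk as (? & ? & ?), Hst as (? & ? & ?).
    split; [|split]; now apply class_C_plus. }
  assert (CT2 : class_C3 2 T).
  { apply (class_C3_is_derive3 1 _ _ HT). now apply class_C3_scal3. }
  set (g := fun x => Vec3 (RInt (fun t => c1 (T t)) 0 x)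
    (RInt (fun t => c2 (T t)) 0 x) (RInt (fun t => c3 (T t)) 0 x)).
  assert (Hg : forall x, is_derive3 g x (T x)).
  { destruct CT1 as (? & ? & ?).
    intros x. split; [|split]; apply indefinite_integral_RInt; intros t;
      now apply (class_C_continuous 1). }
  assert (ET : forall x, tangent g x = T x) by (intros; apply is_derive3_unique, Hg).
  assert (ET' : forall x, deriv3 (tangent g) x = scal3 (k x) (N x)).
  { intros x. rewrite (deriv3_ext _ T x ET). apply is_derive3_unique, HT. }
  assert (Ek : forall x, curvature g x = k x).
  { intros x. unfold curvature, norm3. rewrite ET'.
    transitivity (sqrt (k x * k x * dot3 (N x) (N x))).
    - f_equal. unfold dot3, scal3; simpl. ring.
    - rewrite HNN, Rmult_1_r. apply sqrt_square. specialize (Hpos x). lra. }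
  assert (EN : forall x, normal g x = N x).
  { intros x. unfold normal. rewrite ET', Ek. specialize (Hpos x).
    destruct (N x). unfold scal3; simpl. f_equal; field; lra. }
  assert (EB : forall x, binormal g x = B x).
  { intros x. unfold binormal. now rewrite ET, EN. }
  exists g. split; [|split; [exact Ek|]].
  - split; [|split].
    + now apply (class_C3_is_derive3 2 g T).
    + intros x. unfold norm3. rewrite ET, HTT. apply sqrt_1.
    + intros x. rewrite Ek. apply Hpos.
  - intros x. unfold torsion. rewrite (deriv3_ext _ B x EB), EN.
    rewrite (is_derive3_unique _ _ _ (HB x)).
    transitivity (tau x * dot3 (N x) (N x)).
    + unfold dot3, scal3; simpl. ring.
    + rewrite HNN. ring.
Qed.

(** * The Hasimoto transformation in Madelung variables *)

Theorem proposition4p6 :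
  (forall g : R -> vec3, arclength_curve g ->
     exists rho theta : R -> R,
       madelung_domain rho theta /\ madelung_variables g rho theta) /\
  (forall rho theta : R -> R, madelung_domain rho theta ->
     exists g : R -> vec3,
       arclength_curve g /\ madelung_variables g rho theta) /\
  (forall (g : R -> vec3) (psi : R -> C), arclength_curve g ->
     (hasimoto g psi <->
      exists rho theta : R -> R,
        madelung_domain rho theta /\ madelung_variables g rho theta /\
        forall x : R, psi x = madelung rho theta x)).
Proof.
  split; [|split].
  - intros g Hg.
    assert (Hth : indefinite_integral (fun x => 2 * torsion g x)
      (RInt (fun x => 2 * torsion g x) 0)).
    { apply indefinite_integral_RInt.
      intros x. apply continuous_scal_real. now apply arclength_curve_torsion_continuous. }
    eexists _, _. split; [exact (torsion_primitive_domain g _ Hg Hth)|].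
    split; [reflexivity | exact Hth].
  - intros rho theta (Hrho & Hth & Hpos).
    (* Solving [rho = k^2], [theta' = 2 tau] for [k > 0] and [tau]. The given [theta] is itself an
       admissible primitive, since the constant of integration is free. *)
    destruct (arclength_curve_exists (fun x => sqrt (rho x)) (fun x => / 2 * Derive theta x))
      as (g & Hg & Hk & Htau).
    + now apply class_C_sqrt.
    + intros x. apply sqrt_lt_R0, Hpos.
    + intros x. apply continuous_scal_real, Hth.
    + exists g. split; [exact Hg|]. split.
      * intros x. rewrite Hk, pow2_sqrt; [reflexivity | specialize (Hpos x); lra].
      * intros x. rewrite Htau.
        replace (2 * (/ 2 * Derive theta x)) with (Derive theta x) by field.
        now apply (class_C_is_derive_Derive 0).
  - intros g psi Hg.
    (* Positivity of the curvature identifies the modulus [sqrt rho] with [k]; the phases are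
       matched by [theta = 2 T], in both directions. *)
    assert (Hsq : forall x, sqrt (curvature g x ^ 2) = curvature g x).
    { intros x. apply sqrt_pow2. left. apply Hg. }
    split.
    + intros (T & HT & Hpsi).
      assert (Hth : indefinite_integral (fun x => 2 * torsion g x) (fun x => 2 * T x)).
      { intros x. now apply is_derive_scal. }
      exists (fun x => curvature g x ^ 2), (fun x => 2 * T x).
      split; [now apply torsion_primitive_domain|].
      split; [split; [reflexivity | exact Hth]|].
      intros x. rewrite Hpsi. unfold madelung. rewrite Hsq.
      now replace (2 * T x / 2) with (T x) by field.
    + intros (rho & theta & _ & (Hrho & Hth) & Hpsi).
      exists (fun x => theta x / 2). split.
      * intros x. replace (torsion g x) with (/ 2 * (2 * torsion g x)) by field.
        apply (is_derive_ext (fun x => / 2 * theta x)); [intros; unfold Rdiv; apply Rmult_comm|].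
        apply is_derive_scal, Hth.
      * intros x. rewrite Hpsi. unfold madelung. now rewrite Hrho, Hsq.
Qed.
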